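(* Let $G$ be a finite generalized dihedral group and let $H$ be a nontrivial subgroup of $G$. Then: (a) $H$ is a perfect code of $G$ if and only if $H$ is an $(a,b)$-regular set of $G$ for every pair of integers $a,b$ with $0\leqslant a\leqslant |H|-1$, $0\leqslant b\leqslant |H|$, and $a$ even when $|H|$ is odd; (b) $H$ is a total perfect code of $G$ if and only if $H$ is an $(a,b)$-regular set of $G$ for every pair of integers $a,b$ with $0\leqslant a\leqslant |H|-1$ and $0\leqslant b\leqslant |H|$.
   Context: All groups are finite and all graphs are finite, undirected and simple; $e$ denotes the identity. For a group $G$ and an inverse-closed subset $S\subseteq G\setminus\{e\}$, the Cayley graph $\mathrm{Cay}(G,S)$ has vertex set $G$, with $x,y$ adjacent iff $yx^{-1}\in S$. For a graph $\Gamma$ with vertex set $V$ and nonnegative integers $a,b$, an $(a,b)$-regular set in $\Gamma$ is a nonempty proper subset $C\subset V$ such that every vertex of $C$ has exactly $a$ neighbours in $C$ and every vertex of $V\setminus C$ has exactly $b$ neighbours in $C$. A $(0,1)$-regular set is a perfect code and a $(1,1)$-regular set is a total perfect code. A subset $C$ of a group $G$ is an $(a,b)$-regular set (resp. perfect code, total perfect code) of $G$ if it is an $(a,b)$-regular set (resp. perfect code, total perfect code) in some Cayley graph of $G$. A group $G$ is a generalized dihedral group (with respect to $A$) if $A$ is an abelian subgroup of $G$ and there is $y\in G$ with $G=\langle A,y\mid y^2=e,\ y^{-1}xy=x^{-1}\ \forall x\in A\rangle$. *)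

(* Defs.v *)
From mathcomp Require Import all_boot all_fingroup.

Set Implicit Arguments.
Unset Strict Implicit.
Unset Printing Implicit Defensive.

Local Open Scope group_scope.

Section Graphs.

Variable T : finType.

(* A graph is given by its vertex set V : {set T} and its adjacency relation
   on V; values of adj outside V are irrelevant. *)
Definition regular_set_in (V : {set T}) (adj : rel T) (a b : nat)
    (C : {set T}) : Prop :=
  [/\ C != set0,
      C \proper V,
      forall x, x \in C -> #|[set z in C | adj x z]| = a
    & forall x, x \in V :\: C -> #|[set z in C | adj x z]| = b].

Definition perfect_code_in (V : {set T}) (adj : rel T) (C : {set T}) : Prop :=
  regular_set_in V adj 0 1 C.

Definition total_perfect_code_in (V : {set T}) (adj : rel T) (C : {set T}) :
    Prop :=
  regular_set_in V adj 1 1 C.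

End Graphs.

Section Groups.

Variable gT : finGroupType.

Implicit Types (G : {group gT}) (C S : {set gT}).

Definition connection_set G S : Prop :=
  S \subset G^# /\ (forall s, s \in S -> s^-1 \in S).

Definition cayley_adj S : rel gT := [rel x y | y * x^-1 \in S].

Definition regular_set G (a b : nat) C : Prop :=
  exists2 S : {set gT},
    connection_set G S & regular_set_in G (cayley_adj S) a b C.

Definition perfect_code G C : Prop :=
  exists2 S : {set gT},
    connection_set G S & perfect_code_in G (cayley_adj S) C.

Definition total_perfect_code G C : Prop :=
  exists2 S : {set gT},
    connection_set G S & total_perfect_code_in G (cayley_adj S) C.

(* G = <A, y | y^2 = 1, x^y = x^-1 for all x in A>, stated internally.  The
   group so presented is the extension of A by an element y of order 2 outside
   A; this is what y \notin A records, as the relations alone would also hold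
   in proper quotients.  Here x ^ y = y^-1 * x * y. *)
Definition generalized_dihedral_wrt G (A : {group gT}) : Prop :=
  abelian A /\
  exists y : gT,
    [/\ y \notin A, <<y |: A>> = G, y ^+ 2 = 1
      & forall x, x \in A -> x ^ y = x^-1].

Definition generalized_dihedral G : Prop :=
  exists A : {group gT}, generalized_dihedral_wrt G A.

End Groups.

(* Main.v *)
Require Import Defs.
From mathcomp Require Import all_boot all_fingroup.
From mathcomp Require Import cyclic.

(* Translating by the inverse of a vertex, H is (a,b)-regular in Cay(G,S) iff
   S meets H in a elements and every other right coset of H in b elements.

   Write G with respect to A; every element of G outside A is an involution,
   and every subgroup of A is normal in G.  If H <= A, an inverse-closed S
   meeting each coset X <> H once gives an involution in each X with
   X^-1 = X; hence X contains inverse-closed subsets of every size, and for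
   X^-1 <> X one takes an arbitrary subset of X and its inverse.  If H is not
   contained in A, put B = H :&: A; a coset of H is the union of a coset Bx in A
   and a coset of B made of involutions, any subset of which is inverse-closed.
   If Bx is inverse-closed without involutions, |B| is even and S may take one
   element more of Bx and one less of the other half, so every b is attained. *)

(** * Inverse-closed sets with prescribed numbers of elements in cosets *)

Section InverseClosed.

Local Open Scope group_scope.
Set Implicit Arguments.
Unset Strict Implicit.

Variable gT : finGroupType.
Implicit Types (G K : {group gT}) (T X : {set gT}).

Lemma mem_inv_closed X x : X^-1 = X -> (x^-1 \in X) = (x \in X).
Proof. by move=> XV; rewrite -{1}XV memV_invg. Qed.

Lemma subset_of_card X k :
  k <= #|X| -> exists2 T : {set gT}, T \subset X & #|T| = k.
Proof.
elim: k => [|k IHk] kX; first by exists set0; rewrite ?sub0set ?cards0.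
have [T TX Tk] := IHk (ltnW kX).
have: T \proper X by rewrite properEcard TX Tk.
case/properP=> _ [x xX xT]; exists (x |: T); last by rewrite cardsU1 xT Tk.
by rewrite subUset sub1set xX.
Qed.

(** Elements are added two at a time, as a pair of mutual inverses or as two self-inverse elements;
    an odd [k] starts from one self-inverse element. *)
Lemma inv_closed_subset_of_card X k :
    X^-1 = X -> k <= #|X| -> (odd k -> exists2 x, x \in X & x^-1 = x) ->
  exists T : {set gT}, [/\ T \subset X, T^-1 = T & #|T| = k].
Proof.
move=> XV; have [n] := ubnP k.
elim: n k => // n IHn [|[|k]] /= kn kX oddk.
- by exists set0; rewrite sub0set cards0; split=> //; apply/setP=> x; rewrite !inE.
- have [x xX xV] := oddk isT; exists [set x].
  by rewrite sub1set cards1 invg_set1 xV.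
rewrite negbK in oddk.
have [||T [TX TV Tk]] := IHn k _ _ oddk; [exact: ltnW | exact: ltnW (ltnW kX) |].
have [x xX xT] : exists2 x, x \in X & x \notin T.
  have: T \proper X by rewrite properEcard TX Tk (leq_trans _ kX).
  by case/properP=> _ [x]; exists x.
have ins (z w : gT) : z \in X -> w \in X -> z \notin T -> w \notin T -> z != w ->
    [set z; w]^-1 = [set z; w] ->
    exists T' : {set gT}, [/\ T' \subset X, T'^-1 = T' & #|T'| = k.+2].
  move=> zX wX zT wT zw zwV; exists ([set z; w] :|: T).
  rewrite subUset TX subUset !sub1set zX wX; split=> //.
    by rewrite invUg zwV TV.
  rewrite cardsU cards2 zw Tk (_ : _ :&: T = set0) ?cards0 ?subn0 //.
  by apply/setP=> u; rewrite !inE; do 2!case: eqP => [->|_] //; apply/negbTE.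
have [xV | xV] := eqVneq x^-1 x; last first.
  apply: (ins x x^-1); rewrite ?mem_inv_closed //; first by rewrite eq_sym.
  by rewrite invUg !invg_set1 invgK setUC.
(* At least two elements of [X] lie outside [T], so a self-inverse [x] leaves another candidate
   [w]. *)
have [w wX wT] : exists2 w, w \in X & w \notin x |: T.
  have: x |: T \proper X.
    by rewrite properEcard subUset sub1set xX TX cardsU1 xT Tk.
  by case/properP=> _ [w]; exists w.
move: wT; rewrite !inE negb_or => /andP[wx wT].
have [wV | wV] := eqVneq w^-1 w; last first.
  apply: (ins w w^-1); rewrite ?mem_inv_closed //; first by rewrite eq_sym.
  by rewrite invUg !invg_set1 invgK setUC.
apply: (ins x w) => //; first by rewrite eq_sym.
by rewrite invUg !invg_set1 xV wV.
Qed.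

(** Removing an inverse-closed subset of even size [#|X| - 1] leaves a single element, which
    inversion must fix. *)
Lemma odd_inv_closed X :
  X^-1 = X -> odd #|X| -> exists2 x, x \in X & x^-1 = x.
Proof.
case XE: #|X| => [|n] //= XV evn.
have [||T [TX TV Tn]] := inv_closed_subset_of_card (k := n) XV.
- by rewrite XE.
- by rewrite (negbTE evn).
have /eqP/cards1P[x XTx] : #|X :\: T| = 1%N.
  by rewrite cardsD (setIidPr TX) XE Tn subSnn.
have: x \in X :\: T by rewrite XTx set11.
case/setDP=> xX _; exists x => //.
by apply/set1P; rewrite -XTx in_setD !mem_inv_closed // -in_setD XTx set11.
Qed.

(* A set X with X^-1 <> X is paired with X^-1, and the ordering of {set gT} by
   rank decides on which of the two the subset is chosen freely. *)
Lemma inv_equivariant_choice (P : {set gT} -> Prop) (k : {set gT} -> nat) :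
    (forall X, P X -> P X^-1) ->
    (forall X, P X -> k X <= #|X|) ->
    (forall X, P X -> k X^-1 = k X) ->
    (forall X, P X -> X^-1 = X -> odd (k X) ->
       exists2 x, x \in X & x^-1 = x) ->
  exists F : {set gT} -> {set gT}, forall X, P X ->
    [/\ F X \subset X, F X^-1 = (F X)^-1 & #|F X| = k X].
Proof.
move=> PV kle kV kodd.
pose good X T := [&& T \subset X, #|T| == k X & (X^-1 == X) ==> (T^-1 == T)].
(* By [F0P], the default [set0] is never reached on sets satisfying [P]. *)
pose F0 X := odflt set0 [pick T | good X T].
have F0P X : P X -> good X (F0 X).
  move=> PX; rewrite /F0; case: pickP => //= none.
  have [XV | XV] := eqVneq X^-1 X.
    have [T [TX TV Tk]] := inv_closed_subset_of_card XV (kle X PX) (kodd X PX XV).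
    by have := none T; rewrite /good TX Tk TV !eqxx implybT.
  have [T TX Tk] := subset_of_card (kle X PX).
  by have := none T; rewrite /good TX Tk eqxx (negbTE XV).
exists (fun X => if enum_rank X <= enum_rank X^-1 then F0 X else (F0 X^-1)^-1).
move=> X PX; rewrite invgK.
have /and3P[sX /eqP cX /implyP eX] := F0P X PX.
have /and3P[sXV /eqP cXV _] := F0P _ (PV X PX).
have cXV' : #|(F0 X^-1)^-1| = k X by rewrite card_invg cXV kV.
have sXV' : (F0 X^-1)^-1 \subset X by rewrite -(invSg _ X) invgK.
case: ltngtP => [lt|lt|eqr] /=; rewrite ?invgK //.
have XV : X^-1 = X by apply: enum_rank_inj; apply: val_inj.
by split=> //; rewrite XV; move/eqP: (eX (introT eqP XV)) => ->.
Qed.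

Lemma rcoset_inv_normal G K x :
  K <| G -> x \in G -> (K :* x)^-1 = K :* x^-1.
Proof.
move=> /normal_norm nKG xG.
by rewrite invMg invGid invg_set1 norm_rlcoset // groupV (subsetP nKG).
Qed.

(** Normality makes inversion permute the cosets of [K], so subsets chosen equivariantly in the
    cosets have an inverse-closed union. *)
Lemma inv_closed_rcoset_counts G K (k : {set gT} -> nat) :
    K <| G ->
    (forall x, x \in G -> k (K :* x) <= #|K|) ->
    (forall x, x \in G -> k (K :* x^-1) = k (K :* x)) ->
    (forall x, x \in G -> K :* x^-1 = K :* x -> odd (k (K :* x)) ->
       exists2 u, u \in K :* x & u^-1 = u) ->
  exists S : {set gT},
    S^-1 = S /\ forall x, x \in G -> #|S :&: K :* x| = k (K :* x).
Proof.
move=> nKG kle kV kodd.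
pose P X := exists2 x, x \in G & X = K :* x.
have [X [x xG ->]|X [x xG ->]|X [x xG ->]|X [x xG ->]|F FP] :=
    @inv_equivariant_choice P k.
- by exists x^-1; rewrite ?groupV // (rcoset_inv_normal nKG).
- by rewrite card_rcoset kle.
- by rewrite (rcoset_inv_normal nKG) // kV.
- by rewrite (rcoset_inv_normal nKG) // => ? ?; apply: kodd.
have {}FP x : x \in G -> [/\ F (K :* x) \subset K :* x,
    F (K :* x^-1) = (F (K :* x))^-1 & #|F (K :* x)| = k (K :* x)].
  by move=> xG; rewrite -(rcoset_inv_normal nKG) //; apply: FP; exists x.
exists [set x in G | x \in F (K :* x)]; split.
  apply/setP=> x; rewrite mem_invg !inE groupV; case: (boolP (x \in G)) => //= xG.
  by have [_ -> _] := FP x xG; rewrite memV_invg.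
move=> x xG; have [sFx _ <-] := FP x xG; apply: eq_card => u; rewrite !inE.
apply/idP/idP => [/andP[/andP[_ uF] ux]|uF].
  by rewrite -(rcoset_eqP ux).
have ux := subsetP sFx u uF.
rewrite ux andbT (rcoset_eqP ux) uF andbT.
move: ux; case/rcosetP=> h hK ->.
by rewrite groupM // (subsetP (normal_sub nKG)).
Qed.

End InverseClosed.

(** * Cosets of subgroups in a generalized dihedral group *)

Section GeneralizedDihedral.

Local Open Scope group_scope.
Set Implicit Arguments.
Unset Strict Implicit.

Variable gT : finGroupType.
Implicit Types (G H K A : {group gT}) (S : {set gT}).

Lemma generalized_dihedral_coset G A :
    generalized_dihedral_wrt G A ->
  exists y, [/\ y \in G, A \subset G, y^-1 = y,
    forall x, x \in A -> x ^ y = x^-1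
    & forall g, g \in G -> g \notin A -> exists2 c, c \in A & g = c * y].
Proof.
case=> _ [y [yA defG y2 invy]]; exists y.
have yG : y \in G by rewrite -defG mem_gen // setU11.
have sAG : A \subset G by rewrite -defG sub_gen // subsetUr.
split=> // [|g gG gA]; first by apply/eqP; rewrite eq_invg_mul -[X in _ == X]y2.
have nAy : <[y]> \subset 'N(A).
  rewrite cycle_subG inE; apply/subsetP=> _ /imsetP[x xA ->].
  by rewrite invy // groupV.
have: g \in A * <[y]>.
  rewrite -(norm_joinEr nAy) joing_idr /joing setUC.
  by rewrite -[_ :|: _]/(y |: A) defG.
case/mulsgP=> c _ cA /cycleP[i ->] gE.
rewrite -(odd_double_half i) expgD -mul2n expgM y2 expg1n mulg1 in gE.
by move: gE gA; case: (odd i) => [-> _|->]; [exists c | rewrite mulg1 cA].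
Qed.

(** For [x = c * y] with [c] in [A], the inverse is [y * c^-1 = y * c ^ y = c * y]. *)
Lemma generalized_dihedral_invg G A x :
  generalized_dihedral_wrt G A -> x \in G -> x \notin A -> x^-1 = x.
Proof.
case/generalized_dihedral_coset=> y [yG sAG yV invy cosetG] xG xA.
have [c cA ->] := cosetG x xG xA.
by rewrite invMg yV -(invy c cA) conjgE mulKVg.
Qed.

(** Membership in [A] behaves as a parity, [A] having index two: outside [A], [z = z^-1], and the
    factors [y] cancel in [c * y * (d * y)^-1]. *)
Lemma generalized_dihedral_mulg G A x z :
    generalized_dihedral_wrt G A -> x \in G -> z \in G ->
  (x * z \in A) = (x \in A) (+) ~~ (z \in A).
Proof.
move=> gdG xG zG.
have [y [yG sAG yV invy cosetG]] := generalized_dihedral_coset gdG.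
have [xA | xA] := boolP (x \in A); first by rewrite groupMl // addTb negbK.
have [zA | zA] := boolP (z \in A); first by rewrite groupMr // (negbTE xA).
have [c cA ->] := cosetG x xG xA.
have [d dA zE] := cosetG z zG zA.
rewrite -(generalized_dihedral_invg gdG zG zA) zE invMg.
by rewrite mulgA mulgK groupM ?groupV.
Qed.

(** Conjugation by the abelian [A] fixes each element of [K], and conjugation by [y] inverts it. *)
Lemma generalized_dihedral_normal G A K :
  generalized_dihedral_wrt G A -> K \subset A -> K <| G.
Proof.
move=> gdG sKA; have [cAA _] := gdG.
have [y [yG sAG yV invy cosetG]] := generalized_dihedral_coset gdG.
have nKA : A \subset 'N(K) by rewrite cents_norm // (subset_trans cAA) ?centS.
rewrite /normal (subset_trans sKA sAG); apply/subsetP=> g gG.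
have [gA | gA] := boolP (g \in A); first exact: (subsetP nKA).
have [c cA ->] := cosetG g gG gA; apply: groupM; first exact: (subsetP nKA).
rewrite inE; apply/subsetP=> _ /imsetP[x xK ->].
by rewrite invy ?groupV // (subsetP sKA).
Qed.

Lemma card_setI_rcoset_index2 H A S x z :
    z \in H -> z \notin A ->
    (forall u, u \in H -> u \notin A -> u * z^-1 \in A) ->
  #|S :&: H :* x| =
    #|S :&: (H :&: A) :* x| + #|S :&: (H :&: A) :* (z * x)|.
Proof.
move=> zH zA Az.
have disj : S :&: (H :&: A) :* x :&: (S :&: (H :&: A) :* (z * x)) = set0.
  apply/setP=> u; rewrite !in_setI in_set0 !mem_rcoset !in_setI invMg mulgA.
  apply/negP=> /andP[/andP[_ /andP[_ uA]] /andP[_ /andP[_]]].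
  by rewrite groupMl // groupV (negbTE zA).
rewrite -cardsUI disj cards0 addn0 -setIUr; apply: eq_card => u.
rewrite !in_setI in_setU; congr (_ && _).
rewrite !mem_rcoset !in_setI invMg mulgA (groupMr _ (groupVr zH)).
case: (boolP (_ \in H)) => //= uH.
by case: (boolP (_ \in A)) => //= uA; rewrite Az.
Qed.

Lemma inv_closed_counts_not_sub G A H b :
    generalized_dihedral_wrt G A -> H \subset G -> ~~ (H \subset A) ->
    b <= #|H| ->
  exists S : {set gT}, S^-1 = S /\ forall x, x \in G -> #|S :&: H :* x| = b.
Proof.
move=> gdG sHG /subsetPn[z zH zA] bH.
have zG := subsetP sHG z zH.
have mulA := generalized_dihedral_mulg gdG.
have zV := generalized_dihedral_invg gdG zG zA.
have splitH := @card_setI_rcoset_index2 H A _ _ z zH zA.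
have {}splitH S x : #|S :&: H :* x| =
    #|S :&: (H :&: A) :* x| + #|S :&: (H :&: A) :* (z * x)|.
  apply: splitH => u uH uA.
  by rewrite zV mulA ?(subsetP sHG u) // (negbTE uA) zA.
pose B := (H :&: A)%G.
have nBG : B <| G by apply: generalized_dihedral_normal gdG (subsetIr _ _).
have B_gt0 : 0 < #|B| := cardG_gt0 B.
have cardH : #|H| = #|B| + #|B|.
  by have := splitH setT 1; rewrite !setTI !card_rcoset.
have subA x : x \in G -> (B :* x \subset A) = (x \in A).
  move=> xG; apply/idP/idP => [/subsetP-> //|xA]; first exact: rcoset_refl.
  by rewrite mul_subG ?subsetIr // sub1set.
have zB x : z *: (B :* x) = B :* (z * x).
  have nBz : z \in 'N(B) := subsetP (normal_norm nBG) z zG.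
  by rewrite rcosetM (norm_rlcoset nBz) -mulgA.
(* c counts the elements of S in a coset of B within A.  It is at least b - |B|,
   so that the remaining b - c fit in the other half of the coset of H. *)
pose m := b - #|B|.
pose c (X : {set gT}) :=
  m + [&& odd m, ~~ odd #|B| & [forall u in X, u^-1 != u]].
have m_le : m <= #|B| by rewrite leq_subLR -cardH.
(* When one is added, [m] is odd and [#|B|] even, so [m] is strictly below [#|B|]. *)
have c_le X : c X <= #|B|.
  rewrite /c; case: and3P => [[om oB _]|_]; last by rewrite addn0.
  rewrite addn1 ltn_neqAle m_le andbT; apply: contraNneq oB => <-.
  exact: om.
have c_le_b X : c X <= b.
  rewrite /c; case: and3P => [[om _ _]|_]; last by rewrite addn0 leq_subr.
  (* The subtraction in [m] is truncated; an odd [m] is positive. *)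
  have b_gt : #|B| < b by rewrite -subn_gt0 -/m; case: (m) om.
  by rewrite -(subnK (ltnW b_gt)) leq_add2l.
have b_sub_c X : b - c X <= #|B|.
  rewrite leq_subLR /c -addnA (leq_trans _ (leq_add (leqnn _) (leq_addl _ _))) //.
  by rewrite addnC -leq_subLR.
have cV x : x \in G -> c (B :* x^-1) = c (B :* x).
  move=> xG; rewrite /c -(rcoset_inv_normal nBG xG).
  congr (_ + nat_of_bool [&& _, _ & _]).
  apply/forall_inP/forall_inP => nfix u uB.
    by rewrite -(inj_eq invg_inj) nfix // memV_invg.
  by rewrite -(inj_eq invg_inj) nfix // -mem_invg.
(* Multiplication by [z] sends a half outside [A] to the half within [A] of the same coset of [H];
   the outer half takes the rest of [b]. *)
pose k (X : {set gT}) := if X \subset A then c X else b - c (z *: X).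
have [x xG|x xG|x xG Vx|S [SV Sk]] := @inv_closed_rcoset_counts _ G B k nBG.
- by rewrite /k; case: ifP.
- rewrite /k !subA ?groupV //; case: ifP => xA; first exact: cV.
  by rewrite (generalized_dihedral_invg gdG xG) ?xA.
- rewrite /k subA //; case: (boolP (x \in A)) => xA; last first.
    exists x; first exact: rcoset_refl.
    exact: generalized_dihedral_invg gdG xG xA.
  rewrite /c; case: (boolP (odd #|B|)) => oB.
    move=> _; apply: odd_inv_closed; first by rewrite (rcoset_inv_normal nBG).
    by rewrite card_rcoset.
  (* With [#|B|] even and no self-inverse element in the coset, [c] rounds [m] up to an even
     number. *)
  case: (boolP [forall u in _, _]) => /=; last first.
    by case/forall_inPn=> u uB; rewrite negbK => /eqP; exists u.
  by rewrite andbT oddD; case: (odd m).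
exists S; split=> // x xG.
have zxG : z * x \in G by rewrite groupM.
rewrite splitH !Sk // /k !subA // mulA // !zB.
rewrite (_ : z * (z * x) = x) ?(negbTE zA); last by rewrite -{1}zV mulKg.
by case: (x \in A); rewrite /= ?subnK // subnKC.
Qed.

(** In an inverse-closed coset other than [K], the only element of [S] equals its inverse; in [K]
    itself, [1] does. *)
Lemma inv_closed_counts_normal G K S b :
    K <| G -> S^-1 = S -> (forall x, x \in G :\: K -> #|S :&: K :* x| = 1%N) ->
    b <= #|K| ->
  exists S' : {set gT}, S'^-1 = S' /\ forall x, x \in G -> #|S' :&: K :* x| = b.
Proof.
move=> nKG SV S1 bK.
apply: (@inv_closed_rcoset_counts _ G K (fun=> b)) => // x xG Vx _.
have [xK | xK] := boolP (x \in K).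
  by exists 1; rewrite ?invg1 // (rcoset_id xK).
have /eqP/cards1P[u Su] : #|S :&: K :* x| = 1%N by rewrite S1 // inE xK.
have: u \in S :&: K :* x by rewrite Su set11.
rewrite inE => /andP[uS ux]; exists u => //; apply/set1P; rewrite -Su inE.
by rewrite mem_inv_closed // uS -Vx -(rcoset_inv_normal nKG xG) memV_invg.
Qed.

End GeneralizedDihedral.

(** * Subgroups as regular sets of Cayley graphs *)

Section RegularSubgroups.

Local Open Scope group_scope.
Set Implicit Arguments.
Unset Strict Implicit.

Variable gT : finGroupType.
Implicit Types (G H : {group gT}) (S : {set gT}).

Lemma card_cayley_nbrs H S x :
  #|[set z in H | cayley_adj S x z]| = #|S :&: H :* x^-1|.
Proof.
rewrite -(card_rcoset [set z in H | _] x^-1); apply: eq_card => u.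
by rewrite in_setI !mem_rcoset invgK inE /cayley_adj /= mulgK andbC.
Qed.

Lemma regular_setP G H a b :
  regular_set G a b H <->
  H \proper G /\ exists S : {set gT}, [/\ connection_set G S, #|S :&: H| = a
    & forall x, x \in G :\: H -> #|S :&: H :* x| = b].
Proof.
split=> [[S cS [_ pHG Sa Sb]] | [pHG [S [cS Sa Sb]]]].
  split=> //; exists S; split=> // [|x].
    by rewrite -(Sa 1) // card_cayley_nbrs invg1 rcoset1.
  by rewrite inE => xGH; rewrite -(Sb x^-1) ?inE ?groupV // card_cayley_nbrs invgK.
exists S => //; split=> // [|x xH|x].
- by apply/set0Pn; exists 1.
- by rewrite card_cayley_nbrs rcoset_id ?groupV.
- by rewrite card_cayley_nbrs inE => xGH; apply: Sb; rewrite inE !groupV.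
Qed.

Lemma connection_setV G S : connection_set G S -> S^-1 = S.
Proof.
case=> _ SV; apply/setP=> x; rewrite mem_invg.
by apply/idP/idP=> /SV //; rewrite invgK.
Qed.

(** [S] is kept outside [H], and its part in [H] is replaced by an inverse-closed set of [a]
    nonidentity elements. *)
Lemma regular_set_of_counts G H S a b :
    H \proper G -> S^-1 = S -> (forall x, x \in G -> #|S :&: H :* x| = b) ->
    a <= #|H| - 1 -> (odd #|H| -> ~~ odd a) ->
  regular_set G a b H.
Proof.
move=> pHG SV Sb aH odda.
have sHG := proper_sub pHG.
have HV : (H^#)^-1 = H^#.
  by apply/setP=> x; rewrite mem_invg !inE groupV invg_eq1.
have cH : #|H^#| = #|H| - 1 by rewrite [in RHS](cardsD1 1) group1 addKn.
have [||T [TH TV Ta]] := inv_closed_subset_of_card (k := a) HV; first by rewrite cH.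
  (* An odd [a] forces [#|H|] even, so [H^#] has odd size and contains an involution. *)
  move=> oa; apply: odd_inv_closed => //.
  rewrite cH oddB ?cardG_gt0 // addbT.
  by apply/negP=> /odda; rewrite oa.
apply/regular_setP; split=> //; exists (T :|: S :&: (G :\: H)); split.
- split.
    rewrite subUset (subset_trans TH) ?setSD //=.
    apply/subsetP=> x; rewrite !inE => /and3P[_ xH ->]; rewrite andbT.
    by apply: contraNneq xH => ->.
  by move=> x; rewrite !inE !groupV !mem_inv_closed.
- rewrite -Ta; apply: eq_card => x; rewrite !inE.
  have [xT | _] := boolP (x \in T); last by case: (x \in H); rewrite ?andbF.
  by have /setDP[] := subsetP TH x xT.
- move=> x; rewrite inE => /andP[xH xG]; rewrite -(Sb x xG).
  apply: eq_card => u; rewrite !in_setI in_setU in_setI in_setD.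
  have [ux | _] := boolP (u \in H :* x); last by rewrite !andbF.
  have [h hH uE] := rcosetP ux.
  have uH : u \notin H by rewrite uE groupMl.
  have uG : u \in G by rewrite uE groupM // (subsetP sHG).
  rewrite uH uG !andbT; case: (boolP (u \in T)) => //= uT.
  by have /setDP[] := subsetP TH u uT; rewrite (negbTE uH).
Qed.

(** Taking [a'] to be 0 or 1 covers perfect codes and total perfect codes. *)
Lemma generalized_dihedral_regular_set G H a a' b :
    generalized_dihedral G -> H \subset G -> regular_set G a' 1 H ->
    a <= #|H| - 1 -> b <= #|H| -> (odd #|H| -> ~~ odd a) ->
  regular_set G a b H.
Proof.
move=> [A gdG] sHG /regular_setP[pHG [S [/connection_setV SV _ S1]]] aH bH odda.
have [S' [S'V S'b]] : exists S' : {set gT},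
    S'^-1 = S' /\ forall x, x \in G -> #|S' :&: H :* x| = b.
  have [sHA | nHA] := boolP (H \subset A).
    exact: inv_closed_counts_normal (generalized_dihedral_normal gdG sHA) SV S1 bH.
  exact: inv_closed_counts_not_sub gdG sHG nHA bH.
exact: regular_set_of_counts pHG S'V S'b aH odda.
Qed.

(** The only element of [S] in [H] equals its inverse, so it is an involution and its order divides
    [#|H|]. *)
Lemma regular_set1_even G H b : regular_set G 1 b H -> ~~ odd #|H|.
Proof.
case/regular_setP=> _ [S [cS S1 _]]; have SV := connection_setV cS.
have /eqP/cards1P[s Ss] : #|S :&: H| = 1%N by [].
have: s \in S :&: H by rewrite Ss set11.
rewrite inE => /andP[sS sH].
have sV : s^-1 = s.
  by apply/set1P; rewrite -Ss inE mem_inv_closed // sS groupV.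
have s1 : s != 1 by have /setD1P[] := subsetP cS.1 s sS.
have s2 : #[s] = 2%N.
  apply: nt_prime_order => //.
  by rewrite expgS expg1 -{1}sV mulVg.
by rewrite -dvdn2 -s2 order_dvdG.
Qed.

End RegularSubgroups.

Theorem theorem1p2 (gT : finGroupType) (G H : {group gT})
    (gdG : generalized_dihedral G) (sHG : H \subset G)
    (ntH : H != 1%G) :
  (perfect_code G H <->
     (forall a b : nat, a <= #|H| - 1 -> b <= #|H| ->
        (odd #|H| -> ~~ odd a) -> regular_set G a b H)) /\
  (total_perfect_code G H <->
     (forall a b : nat, a <= #|H| - 1 -> b <= #|H| -> regular_set G a b H)).
Proof.
have gdreg := fun a a' b => @generalized_dihedral_regular_set gT G H a a' b gdG sHG.
split; split.
- by move=> pc a b aH bH odda; apply: gdreg pc aH bH odda.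
- by apply=> //; apply: cardG_gt0.
- move=> tpc a b aH bH; have evenH := regular_set1_even tpc.
  by apply: gdreg tpc aH bH _; rewrite (negbTE evenH).
(* The pair (1, 1) is admissible because a nontrivial [H] has at least two elements. *)
- apply; last exact: cardG_gt0.
  by rewrite subn_gt0 cardG_gt1.
Qed.
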